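(* Let $k\ge 1$ be an integer and let $G$ be a finite simple connected graph that is $k$-chromatic. Then $G$ contains at least $k^{k-2}$ spanning trees.
   Context: A graph is $k$-chromatic if it admits a proper vertex coloring using $k$ colors but does not admit one using $k-1$ colors, i.e. its chromatic number equals $k$. The spanning trees of $G$ are counted as distinct subgraphs of $G$ (equivalently, as distinct edge sets), not up to isomorphism. For $k=1$ the quantity $k^{k-2}$ is $1^{-1}=1$. *)

(* Defs.v *)
(* A finite simple graph is a symmetric irreflexive relation
   on a finType of vertices. *)
From mathcomp Require Import all_boot.

Set Implicit Arguments.
Unset Strict Implicit.
Unset Printing Implicit Defensive.

Section Graphs.

Variable T : finType.
Implicit Types (e r : rel T) (F : {set {set T}}) (k : nat).

Definition connected_graph r : bool := [forall x, forall y, connect r x y].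

(* For irreflexive symmetric r, the cycles of the graph are the r-cycles on
   pairwise distinct vertices having length at least 3: every edge xy also gives
   the degenerate r-cycle [:: x; y].  Distinctness bounds the length by #|T|,
   which makes the predicate boolean; acyclicP removes the bound. *)
Definition acyclic_graph r : bool :=
  [forall n : 'I_#|T|.+1, forall c : n.-tuple T, ucycleb r c ==> (n <= 2)].

Lemma acyclicP r :
  reflect (forall c : seq T, ucycle r c -> size c <= 2) (acyclic_graph r).
Proof.
apply: (iffP forallP) => [acr c Cc | acr n].
  have lt_c : size c < #|T|.+1.
    by case/andP: Cc => _ Uc; rewrite ltnS -(card_uniqP Uc) max_card.
  by have /forallP/(_ (in_tuple c))/implyP := acr (Ordinal lt_c); apply.
apply/forallP=> c; apply/implyP=> Cc.
by rewrite -[X in X <= _](size_tuple c); apply: acr.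
Qed.

Definition edges e : {set {set T}} :=
  [set [set p.1; p.2] | p : T * T & e p.1 p.2].

Definition adj F : rel T := [rel x y | [set x; y] \in F].

Definition spanning_tree e F : bool :=
  [&& F \subset edges e, connected_graph (adj F) & acyclic_graph (adj F)].

Definition spanning_trees e : {set {set {set T}}} :=
  [set F | spanning_tree e F].

Definition colorable e k : bool :=
  [exists f : {ffun T -> 'I_k}, forall x, forall y, e x y ==> (f x != f y)].

Definition chromatic e k : bool := colorable e k && ~~ colorable e k.-1.

End Graphs.

(* Main.v *)
(* If u and v are nonadjacent vertices of a connected graph with a common
   neighbor, identifying them does not decrease the chromatic number, and does
   not increase the number of spanning trees either: a tree of the quotient is
   lifted by splitting the merged vertex back into u and v and adding one edge
   that joins u or v to a common neighbor, and it can be recovered from its lift.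
   A connected graph without such a pair is complete, so repeated identification
   ends at some K_m with m >= k, which has at least m^(m-2) spanning trees. *)
Require Import Defs.
From mathcomp Require Import all_boot.
From mathcomp Require Import zify.

Set Implicit Arguments.
Unset Strict Implicit.
Unset Printing Implicit Defensive.

(** * Edge sets, and trees recognized by connectivity and edge count *)

Section EdgeSets.

Variable T : finType.
Implicit Types (e : rel T) (F : {set {set T}}) (V : {set T}) (x y : T).

Lemma adj_sym F : symmetric (adj F).
Proof. by move=> x y; rewrite /adj /= setUC. Qed.

Lemma connect_adjC F : connect_sym (adj F).
Proof. exact/sym_connect_sym/adj_sym. Qed.

Lemma edgesP e E : reflect (exists2 p : T * T, e p.1 p.2 & E = [set p.1; p.2])
                           (E \in edges e).
Proof. by apply: (iffP imsetP) => -[p]; rewrite ?inE => ep ->; exists p; rewrite ?inE. Qed.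

Lemma set2_eq (a b c d : T) : [set a; b] = [set c; d] ->
  (a = c /\ b = d) \/ (a = d /\ b = c).
Proof.
move=> E; have: a \in [set c; d] by rewrite -E set21.
have: b \in [set c; d] by rewrite -E set22.
have: c \in [set a; b] by rewrite E set21.
have: d \in [set a; b] by rewrite E set22.
rewrite !inE.
by do 4![case/orP=> /eqP ?; subst]; auto.
Qed.

Lemma edges2 e x y : symmetric e -> ([set x; y] \in edges e) = e x y.
Proof.
move=> e_sym; apply/edgesP/idP => [[[a b] /= eab]|exy]; last by exists (x, y).
by move/set2_eq=> [[-> ->]|[-> ->]] //; rewrite e_sym.
Qed.

(** The vertex set is a parameter because identification shrinks it inside the fixed type [T]. The
    edge count stands in for acyclicity. *)
Definition tree V e F : bool :=
  [&& F \subset edges e,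
      [forall x in V, forall y in V, connect (adj F) x y] & #|F| < #|V|].

Definition trees V e : {set {set {set T}}} := [set F | tree V e F].

(** A vertex set grown from [r] gains, with each new vertex, a fresh edge of [F] inside it. *)
Lemma connected_card F : connected_graph (adj F) -> #|T| <= #|F|.+1.
Proof.
move=> /forallP conF; case: (posnP #|T|) => [->//|/card_gt0P[r _]].
have grow m : m < #|T| -> exists2 S : {set T},
    (r \in S) && (#|S| == m.+1) & m <= #|[set E in F | E \subset S]|.
  elim: m => [_|m IHm lt_m]; first by exists [set r]; rewrite // set11 cards1.
  have [S /andP[rS /eqP cardS] leS] := IHm (ltnW lt_m).
  have [y yS]: exists y, y \notin S.
    apply/existsP; rewrite -negb_forall; apply/negP=> /forallP allS.
    have: #|T| <= #|S| by apply/subset_leq_card/subsetP=> y _; apply: allS.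
    by rewrite cardS leqNgt lt_m.
  (* A walk from [r] to [y] has a first edge that leaves [S]. *)
  have [a [b [aS bS ab]]]: exists a b, [/\ a \in S, b \notin S & adj F a b].
    have /forallP/(_ y)/connectP[s] := conF r; move: (r) (rS) => a aS.
    elim: s a aS => [|b s IHs] a aS /=; first by move=> _ ya; rewrite ya aS in yS.
    case/andP=> ab sP yE; have [bS|bS] := boolP (b \in S); first exact: IHs b bS sP yE.
    by exists a, b.
  exists (b |: S); first by rewrite !inE rS orbT cardsU1 bS cardS add1n eqxx.
  apply: leq_trans _ (_ : #|[set a; b] |: [set E in F | E \subset S]| <= _); last first.
    apply/subset_leq_card/subsetP=> E; rewrite !inE => /orP[/eqP->|/andP[-> ES]].
      rewrite -[_ \in F]/(adj F a b) ab; apply/subsetP=> z.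
      by rewrite !inE => /orP[]/eqP->; rewrite ?aS ?eqxx ?orbT.
    exact: subset_trans ES (subsetUr _ _).
  rewrite cardsU1 !inE negb_and orbC.
  suff ->: ~~ ([set a; b] \subset S) by [].
  by apply/subsetPn; exists b; rewrite ?set22.
have: #|T|.-1 < #|T| by rewrite prednK //; apply/card_gt0P; exists r.
move=> /grow[S _ leS]; rewrite -ltnS prednK in leS *; last by apply/card_gt0P; exists r.
by apply: leq_trans leS _; rewrite ltnS; apply/subset_leq_card/subsetP=> E; rewrite inE => /andP[].
Qed.

(** Deleting an edge of a cycle would keep the graph connected, with too few edges for
    [connected_card]. *)
Lemma connected_card_acyclic F :
  connected_graph (adj F) -> #|F| < #|T| -> acyclic_graph (adj F).
Proof.
move=> conF ltF; apply/acyclicP=> -[|a [|b [|d s]]] // /andP[].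
rewrite /cycle [path _ _ _]/= => /and3P[ab bd ds] uc; exfalso.
move: uc; rewrite !cons_uniq !inE !negb_or => /and4P[/and3P[nab nad nas] /andP[nbd nbs] nds us].
set F' := F :\ [set a; b].
have adj_out x y : x \notin [set a; b] -> adj F x y -> adj F' x y.
  move=> nx; rewrite /adj /= /F' !inE => ->; rewrite andbT; apply: contra nx => /eqP <-.
  by rewrite set21.
have dout : d \notin [set a; b] by rewrite !inE negb_or !(eq_sym d) nad.
(* The vertices of the cycle after [b] differ from [a] and [b], so the way from [d] back to [a]
   survives the deletion. *)
have con_da : connect (adj F') d a.
  elim: s d ds dout nas nbs {bd nad nbd nds us} => [|c s IHs] d /=.
    by rewrite andbT => da dout _ _; apply/connect1/adj_out.
  case/andP=> dc cs dout; rewrite !inE !negb_or => /andP[nac nas] /andP[nbc nbs].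
  apply: connect_trans (connect1 (adj_out _ _ dout dc)) _; apply: IHs => //.
  by rewrite !inE negb_or !(eq_sym c) nac.
have con_ab : connect (adj F') a b.
  rewrite connect_adjC; apply: connect_trans con_da; rewrite connect_adjC.
  by apply/connect1/adj_out; rewrite // adj_sym.
have con' : connected_graph (adj F').
  apply/forallP=> x; apply/forallP=> y.
  have /forallP/(_ x)/forallP/(_ y) := conF; apply: connect_sub => {}x {}y xy.
  have [E|nE] := eqVneq [set x; y] [set a; b].
    by have [[-> ->]|[-> ->]] := set2_eq E; rewrite // connect_adjC.
  by apply: connect1; rewrite /adj /= /F' !inE nE.
have := connected_card con'; rewrite leqNgt.
by move: ltF; rewrite (cardsD1 [set a; b] F) -/F' -[_ \in F]/(adj F a b) ab add1n => ->.
Qed.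

Lemma trees_spanning e : trees [set: T] e \subset spanning_trees e.
Proof.
apply/subsetP=> F; rewrite !inE => /and3P[Fe /forall_inP conF ltF].
have con : connected_graph (adj F).
  apply/forallP=> x; apply/forallP=> y.
  by have /forall_inP := conF x (in_setT x); apply; rewrite inE.
by rewrite /spanning_tree Fe con connected_card_acyclic // -cardsT.
Qed.

End EdgeSets.

(** * Counting rooted forests *)

Section RootedForests.

Variable S : finType.
Implicit Types (p q : {ffun S -> S}).

(* A rooted forest on [S] is encoded by its parent function, whose fixed points
   are the roots. *)
Definition rooted_forests a : {set {ffun S -> S}} :=
  [set p : {ffun S -> S} | [forall x, exists r, fconnect p x r && (p r == r)]
           & #|[set x | p x != x]| == a].

Lemma fconnect_root_inj p x r s :
  p r = r -> p s = s -> fconnect p x r -> fconnect p x s -> r = s.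
Proof.
move=> pr ps /iter_findex; set m := findex _ _ _ => xr /iter_findex; set n := findex _ _ _ => xs.
have st k z : p z = z -> iter k p z = z by move=> pz; elim: k => //= k ->.
have: iter (m + n) p x = s by rewrite iterD xs st.
by rewrite addnC iterD xr st.
Qed.

Definition graft p (z y : S) : {ffun S -> S} := [ffun x => if x == z then y else p x].

(** The path from [y] to its root avoids [z] and survives the grafting; a path that used to reach
    [z] now continues through [y] to that root. *)
Lemma graft_forest a p z y : p \in rooted_forests a -> p z = z ->
  ~~ fconnect p y z -> graft p z y \in rooted_forests a.+1.
Proof.
rewrite !inE => /andP[/forallP rp /eqP cp] pz nyz.
have gE x : x != z -> graft p z y x = p x by rewrite ffunE => /negbTE->.
have gz : graft p z y z = y by rewrite ffunE eqxx.
have nyz' : y != z by apply: contraNneq nyz => ->.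
have y_ok : exists r, fconnect (graft p z y) y r && (graft p z y r == r).
  have /existsP[r /andP[yr pr]] := rp y; exists r.
  have rz : r != z by apply: contraNneq nyz => <-.
  rewrite gE // pr andbT; move: (yr) => /iter_findex <-.
  suff ->: iter (findex p y r) p y = iter (findex p y r) (graft p z y) y by apply: fconnect_iter.
  elim: (findex _ _ _) => //= m <-; rewrite gE //.
  by apply: contraNneq nyz => <-; apply: fconnect_iter.
apply/andP; split.
  apply/forallP=> x; apply/existsP.
  have z_ok : fconnect (graft p z y) x z ->
      exists r, fconnect (graft p z y) x r && (graft p z y r == r).
    move=> xz; have [r /andP[yr gr]] := y_ok; exists r; rewrite gr andbT.
    by apply: connect_trans xz (connect_trans _ yr); rewrite -[in X in connect _ _ X]gz fconnect1.
  have step m : fconnect (graft p z y) x (iter m p x) \/ fconnect (graft p z y) x z.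
    elim: m => [|m [IHm|]]; [by left| |by right].
    have [E|nE] := eqVneq (iter m p x) z; first by right; rewrite E in IHm.
    by left; apply: connect_trans IHm _; rewrite /= -gE // fconnect1.
  have /existsP[r /andP[xr pr]] := rp x.
  have [] := step (findex p x r); last exact: z_ok.
  rewrite iter_findex // => xr'; have [E|nE] := eqVneq r z; first by apply: z_ok; rewrite -{2}E.
  by exists r; rewrite gE // pr xr'.
have ->: [set x | graft p z y x != x] = z |: [set x | p x != x].
  apply/setP=> x; rewrite !inE; have [->|nx] := eqVneq x z; first by rewrite gz nyz'.
  by rewrite gE.
by rewrite cardsU1 cp !inE pz eqxx.
Qed.

(* Pitman's double counting of pairs (forest with a+1 edges, edge of it): cutting the
   edge above z leaves a forest with a edges in which z is a root and its former
   parent y lies in another component. *)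
Lemma rooted_forestsS a :
  #|rooted_forests a| * (#|S| * (#|S| - a.+1)) <= #|rooted_forests a.+1| * a.+1.
Proof.
(* [D] lists the possible graftings onto forests with [a] edges, [R] the forests with [a.+1] edges
   and a chosen edge, named by its child [z]. Grafting injects [D] into [R]. *)
pose D := [set t : {ffun S -> S} * (S * S) |
   [&& t.1 \in rooted_forests a, t.1 t.2.2 == t.2.2 & ~~ fconnect t.1 t.2.1 t.2.2]].
pose R := [set t : {ffun S -> S} * S | (t.1 \in rooted_forests a.+1) && (t.1 t.2 != t.2)].
have ->: #|rooted_forests a.+1| * a.+1 = #|R|.
  rewrite -[#|R|]sum1_card (eq_bigl (fun t : {ffun S -> S} * S =>
    (t.1 \in rooted_forests a.+1) && (t.1 t.2 != t.2))); last by move=> t; rewrite inE.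
  rewrite -(pair_big_dep (fun p => p \in rooted_forests a.+1)
     (fun (p : {ffun S -> S}) z => p z != z) (fun _ _ => 1)) /=.
  rewrite -sum_nat_const; apply: eq_bigr => p; rewrite inE => /andP[_ /eqP <-].
  by rewrite -sum1_card; apply: eq_bigl => z; rewrite inE.
have leD : #|rooted_forests a| * (#|S| * (#|S| - a.+1)) <= #|D|.
  rewrite -[#|D|]sum1_card (eq_bigl (fun t : {ffun S -> S} * (S * S) =>
    (t.1 \in rooted_forests a) && ((t.1 t.2.2 == t.2.2) && ~~ fconnect t.1 t.2.1 t.2.2)));
    last by move=> t; rewrite inE.
  rewrite -(pair_big_dep (fun p => p \in rooted_forests a)
     (fun (p : {ffun S -> S}) (t : S * S) => (p t.2 == t.2) && ~~ fconnect p t.1 t.2)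
     (fun _ _ => 1)) /=.
  rewrite -[leqLHS]sum_nat_const; apply: leq_sum => p; rewrite inE => /andP[/forallP rp /eqP cp].
  rewrite -(pair_big_dep xpredT (fun y z => (p z == z) && ~~ fconnect p y z) (fun _ _ => 1)) /=.
  rewrite -[#|S|]sum1_card big_distrl /=; apply: leq_sum => y _; rewrite mul1n.
  have /existsP[r /andP[yr /eqP pr]] := rp y.
  rewrite sum1_card -[leqLHS]/(#|S| - a.+1) -cp.
  rewrite leq_subLR -addn1 -addnA -{1}(cards1 r) -cardsT.
  (* The nonroots, the root [r] of [y] and the admissible [z] cover [S]. *)
  apply: leq_trans _ (_ : #|[set x | p x != x] :|: ([set r] :|: [set z | (p z == z) && ~~ fconnect p y z])| <= _).
    apply/subset_leq_card/subsetP=> z _; rewrite !inE; case: eqP => //= pz.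
    have [//|nzr] := eqVneq z r; apply: contra nzr => yz.
    by rewrite (fconnect_root_inj pz pr yz yr).
  apply: leq_trans (leq_card_setU _ _) _; rewrite leq_add2l.
  apply: leq_trans (leq_card_setU _ _) _; rewrite leq_add2l.
  by rewrite cardsE sum1_card.
apply: leq_trans leD _.
pose f (t : {ffun S -> S} * (S * S)) := (graft t.1 t.2.2 t.2.1, t.2.2).
(* Grafting overwrites only the value at [z], which was [z] itself. *)
have injf : {in D &, injective f}.
  move=> [p [y z]] [q [y' z']]; rewrite !inE /= => /and3P[_ /eqP pz _] /and3P[_ /eqP qz _].
  case=> /ffunP E zz; subst z'; have := E z; rewrite !ffunE eqxx => <-.
  congr (_, _); apply/ffunP=> x; have := E x; rewrite !ffunE.
  by case: eqP => // ->; rewrite pz qz.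
rewrite -(card_in_imset injf); apply/subset_leq_card/subsetP=> t /imsetP[[p [y z]] Dt ->].
move: Dt; rewrite inE /= => /and3P[pF /eqP pz nyz]; rewrite inE /= (graft_forest pF) //=.
by rewrite ffunE eqxx; apply: contraNneq nyz => ->.
Qed.

(** The factor [#|S| - a.+1] of the double counting turns ['C(#|S|.-1, a)] into
    [a.+1 * 'C(#|S|.-1, a.+1)]. *)
Lemma card_rooted_forests a :
  'C(#|S|.-1, a) * #|S| ^ a <= #|rooted_forests a|.
Proof.
elim: a => [|a IHa].
  rewrite bin0 mul1n expn0 card_gt0; apply/set0Pn; exists [ffun x => x]; rewrite inE.
  apply/andP; split; first by apply/forallP=> x; apply/existsP; exists x; rewrite ffunE eqxx connect0.
  by rewrite cards_eq0; apply/eqP/setP=> x; rewrite !inE ffunE eqxx.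
rewrite -(@leq_pmul2r a.+1) //; apply: leq_trans (rooted_forestsS a).
apply: leq_trans (leq_mul IHa (leqnn _)).
have ->: 'C(#|S|.-1, a.+1) * #|S| ^ a.+1 * a.+1 = a.+1 * 'C(#|S|.-1, a.+1) * #|S| ^ a.+1.
  by rewrite mulnC mulnA.
by rewrite mul_bin_left -subn1 -subnDA add1n expnS; apply/eq_leq; nia.
Qed.

End RootedForests.

(** * Cayley's lower bound for complete graphs *)

Section CompleteGraph.

Variables (T S : finType) (h : S -> T).
Hypothesis h_inj : injective h.
Implicit Types p q : {ffun S -> S}.

Definition parent_edges p : {set {set T}} :=
  [set [set h x; h (p x)] | x in [set x | p x != x]].

(** Induction on the distance to the root. In [q] the edge {x, p x} belongs to [x], so that
    [q x = p x], or to [p x]; then induction gives [p (p x) = x], and the orbit of [x] never settles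
    at [r]. *)
Lemma parent_edges_inj p q r : p r = r -> q r = r ->
  (forall x, fconnect p x r) -> (forall x, q x = x -> x = r) ->
  parent_edges p = parent_edges q -> p = q.
Proof.
move=> pr qr p_r q_r E; apply/ffunP=> x.
move: (findex p x r) (iter_findex (p_r x)) => m; elim: m x => [x /= ->|m IHm x]; first by rewrite pr qr.
rewrite iterSr => mr; have [px|npx] := eqVneq (p x) x; first by apply: IHm; rewrite px in mr *.
have: [set h x; h (p x)] \in parent_edges q by rewrite -E; apply/imset_f; rewrite inE.
case/imsetP=> w _ /set2_eq[[/h_inj<- /h_inj]//|[/h_inj xw /h_inj pw]].
have := IHm _ mr; rewrite pw -xw => ppx.
have cyc k : (iter k p w == x) || (iter k p w == w).
  by elim: k => [|k /orP[]/eqP /= ->]; rewrite ?ppx ?pw eqxx ?orbT.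
have := cyc m; rewrite pw in mr; rewrite mr => /orP[]/eqP rE; first by rewrite -rE pr eqxx in npx.
by rewrite -rE pr in ppx; rewrite pw -rE ppx eqxx in npx.
Qed.

End CompleteGraph.

(** A forest with [n.-1] edges has a single root. Pairing it with the edge set embeds these forests
    into [V] times the trees, so [n ^ n.-1] is at most [n] times the number of trees. *)
Lemma cayley_lower_bound (T : finType) (V : {set T}) (e : rel T) :
  V != set0 -> {in V &, forall x y, x != y -> e x y} ->
  #|V| ^ (#|V| - 2) <= #|trees V e|.
Proof.
move=> V0 complete; set n := #|V|; have n_gt0 : 0 < n by rewrite card_gt0.
pose S : finType := {x : T | x \in V}; pose h : S -> T := val.
have [x0 x0V] := set0Pn _ V0; have cardS : #|S| = n by rewrite card_sig.
pose X := rooted_forests S n.-1.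
(* The default [x0] is never returned on [X], whose members have a fixed point. *)
pose root (p : {ffun S -> S}) : S := odflt (Sub x0 x0V) [pick r | p r == r].
have rootP (p : {ffun S -> S}) : p \in X ->
    [/\ p (root p) = root p, forall x, p x = x -> x = root p & forall x, fconnect p x (root p)].
  rewrite inE => /andP[/forallP rp /eqP cp].
  have /cards1P[r rE]: #|[set x | p x == x]| == 1.
    have := cardsC [set x | p x == x]; rewrite cardS.
    have ->: ~: [set x | p x == x] = [set x | p x != x] by apply/setP=> x; rewrite !inE.
    by rewrite cp => E; apply/eqP; lia.
  have fixE x : p x = x -> x = r by move=> px; apply/set1P; rewrite -rE inE px.
  have -> : root p = r.
    have pr : p r == r by have := set11 r; rewrite -rE inE.
    by rewrite /root; case: pickP => [s /eqP/fixE|/(_ r)] //=; rewrite pr.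
  split=> // [|x]; first by apply/eqP; have := set11 r; rewrite -rE inE.
  by have /existsP[s /andP[xs /eqP/fixE <-]] := rp x.
have injf : {in X &, injective (fun p => (root p, parent_edges h p))}.
  move=> p q /rootP[pr _ pc] /rootP[qr qu _] [rs E].
  by rewrite -rs in qr qu; apply: parent_edges_inj val_inj _ _ _ pr qr pc qu E.
rewrite -(leq_pmul2l n_gt0) -expnS.
have leX : n ^ n.-1 <= #|X|.
  by have := @card_rooted_forests S n.-1; rewrite cardS binn mul1n.
apply: (@leq_trans (n ^ n.-1)).
  (* For [n = 1] the exponents [(n - 2).+1] and [n.-1] differ, but the base is 1. *)
  by case: (n) n_gt0 => [//|[|m]] _ //; rewrite subn2.
apply: leq_trans leX _; rewrite -(card_in_imset injf) -cardS -cardsT -cardsX.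
apply/subset_leq_card/subsetP=> t /imsetP[p pX ->]; rewrite !inE /=.
have [pr pu pc] := rootP p pX; apply/and3P; split.
- apply/subsetP=> E /imsetP[x]; rewrite inE => npx ->; apply/edgesP.
  exists (h x, h (p x)) => //=; apply: complete; try exact: valP.
  by rewrite eq_sym (inj_eq val_inj).
- have con x : connect (adj (parent_edges h p)) (h x) (h (root p)).
    have := iter_findex (pc x); move: (findex _ _ _) => m; elim: m x => [x /= ->//|m IHm x].
    rewrite iterSr => /IHm; apply: connect_trans.
    have [->//|npx] := eqVneq (p x) x; apply: connect1.
    by rewrite /adj /=; apply/imset_f; rewrite inE.
  apply/forall_inP=> x xV; apply/forall_inP=> y yV.
  apply: connect_trans (con (Sub x xV)) _; rewrite connect_adjC; exact: con (Sub y yV).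
- apply: leq_ltn_trans (leq_imset_card _ _) _.
  by move: pX; rewrite inE => /andP[_ /eqP->]; rewrite prednK.
Qed.

(** * Identifying two nonadjacent vertices with a common neighbor *)

Section Identification.

Variables (T : finType) (V : {set T}) (e : rel T) (u v c0 : T).
Hypotheses (e_sym : symmetric e) (e_irr : irreflexive e).
Hypothesis e_supp : forall x y, e x y -> x \in V.
Hypotheses (neq_uv : u != v) (nuv : ~~ e u v) (uc0 : e u c0) (vc0 : e v c0).
Implicit Types (x y : T) (E : {set T}) (F : {set {set T}}).

(* The merged vertex keeps the name u. *)
Definition identify : rel T := [rel x y |
  [&& x != v, y != v & [|| e x y, (x == u) && e v y | (y == u) && e x v]]].

Definition proj x := if x == v then u else x.

Lemma identify_sym : symmetric identify.
Proof.
move=> x y; rewrite /identify /= andbCA; do 2!congr (_ && _).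
by rewrite e_sym; congr (_ || _); rewrite orbC ![e _ v]e_sym.
Qed.

(** A loop at the merged vertex could come only from an edge between [u] and [v]. *)
Lemma identify_irr : irreflexive identify.
Proof.
move=> x; rewrite /identify /= e_irr; case: eqVneq => //= _; case: eqVneq => //= ->.
by rewrite e_sym orbb; apply/negbTE.
Qed.

Lemma identify_supp x y : identify x y -> x \in V :\ v.
Proof.
rewrite !inE => /and3P[-> _] /or3P[/e_supp//|/andP[/eqP-> _]|/andP[_ /e_supp]//].
exact: e_supp uc0.
Qed.

(** As a homomorphism, [proj] carries walks to the quotient and pulls colorings back from it. *)
Lemma proj_edge x y : e x y -> identify (proj x) (proj y).
Proof.
rewrite /proj /identify => exy /=.
case: (eqVneq x v) exy => [->|nx]; case: (eqVneq y v) => [->|ny].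
- by rewrite e_irr.
- by move=> evy; rewrite neq_uv ny eqxx evy orbT.
- by move=> exv; rewrite neq_uv nx eqxx exv !orbT.
- by move=> ->; rewrite nx ny.
Qed.

Lemma identify_connected : {in V &, forall x y, connect e x y} ->
  {in V :\ v &, forall x y, connect identify x y}.
Proof.
move=> con x y; rewrite !inE => /andP[nx xV] /andP[ny yV].
have /connectP[s sP yE] := con x y xV yV.
have projE z : z != v -> proj z = z by rewrite /proj => /negbTE->.
rewrite -(projE x nx) -(projE y ny) yE; elim: s x sP {nx xV yE} => //= z s IHs x /andP[exz sP].
by apply: connect_trans (connect1 (proj_edge exz)) _; apply: IHs.
Qed.

Definition proj_set E := if v \in E then u |: (E :\ v) else E.

(* An edge at u that does not exist in the original graph is moved to v. *)
Definition split_set E :=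
  if (u \in E) && (E \notin edges e) then v |: (E :\ u) else E.

Definition common c := e u c && e v c.

(** These are the edges merged in pairs by [proj_set]: both {u, c} and {v, c} project to {u, c}. *)
Definition shared_edges : {set {set T}} :=
  [set E | [exists c, common c && ((E == [set u; c]) || (E == [set v; c]))]].

Section Lift.

Variable F : {set {set T}}.
Hypothesis F_tree : tree (V :\ v) identify F.

Let F_edges : F \subset edges identify. Proof. by case/and3P: F_tree. Qed.

Lemma split_setK E : E \in F -> proj_set (split_set E) = E.
Proof.
move=> /(subsetP F_edges)/edgesP[[x y] /and3P[/= xv yv _] ->].
have nv : v \notin [set x; y] by rewrite !inE negb_or !(eq_sym v) xv.
rewrite /split_set; case: ifP => [/andP[uE _]|_]; last by rewrite /proj_set (negbTE nv).
rewrite /proj_set setU11 setU1K ?setD1K //.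
by rewrite in_setD1 (negbTE nv) andbF.
Qed.

(** A quotient edge at [u] that is not an original edge comes from an edge at [v]. *)
Lemma split_set_edge E : E \in F -> split_set E \in edges e.
Proof.
move=> EF; have := subsetP F_edges _ EF; rewrite /split_set.
case: ifP => [/andP[uE nE]|/negbT]; last first.
  rewrite negb_and negbK => /orP[nu|//] /edgesP[[x y] /and3P[/= xv yv exy] EE].
  move: nu; rewrite EE !inE negb_or !(eq_sym u) => /andP[xu yu].
  by move: exy; rewrite (negbTE xu) (negbTE yu) !orbF edges2.
move/edgesP=> [[x y] /= ixy EE].
wlog xu : x y ixy EE / x = u.
  move=> W; have /set2P[uE'|uE'] : u \in [set x; y] by rewrite -EE.
      exact: (W x y ixy EE (esym uE')).
  by apply: (W y x); rewrite // 1?identify_sym // EE setUC.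
subst x; have nyu : y != u by apply: contraTneq ixy => ->; rewrite identify_irr.
have evy : e v y.
  case/and3P: ixy => _ yv /or3P[euy|/andP[]//|/andP[/eqP yu]].
    by rewrite EE edges2 ?euy in nE.
  by rewrite yu eqxx in nyu.
by rewrite EE setU1K ?edges2 // inE eq_sym.
Qed.

Definition pre_lift := split_set @: F.

Lemma pre_lift_adj x y : adj F x y ->
  [|| adj pre_lift x y, (x == u) && adj pre_lift v y | (y == u) && adj pre_lift x v].
Proof.
move=> xy; have := imset_f split_set xy; rewrite -/pre_lift.
rewrite {1}/split_set; case: ifP => [/andP[]|_ H]; last by apply/orP; left.
have := subsetP F_edges _ xy; rewrite (edges2 _ _ identify_sym) => ixy.
have nxy : x != y by apply: contraTneq ixy => ->; rewrite identify_irr.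
case/set2P=> ux _; move: nxy; rewrite -ux => nuy.
  by rewrite setU1K ?inE // => H; rewrite eqxx /adj /= H orbT.
by rewrite [[set x; u]]setUC setU1K ?inE 1?eq_sym // => H; rewrite eqxx (adj_sym _ x v) /adj /= H !orbT.
Qed.

(** A walk of [F] towards [u] lifts edge by edge until it meets [u], where the lifted edge ends at
    [u] or [v]. Hence one edge suffices to reconnect the pre-lift. *)
Lemma pre_lift_reach x : x \in V :\ v ->
  connect (adj pre_lift) x u || connect (adj pre_lift) x v.
Proof.
move=> xV; have /and3P[_ /forall_inP/(_ _ xV)/forall_inP conF _] := F_tree.
have /connectP[s sP uE] : connect (adj F) x u.
  by apply: conF; rewrite !inE neq_uv (e_supp uc0).
elim: s x sP uE {xV conF} => [x _ /= ->|y s IHs x /= /andP[xy sP] uE]; first by rewrite connect0.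
have /or3P[xy'|/andP[/eqP-> _]|/andP[_ /connect1->]] := pre_lift_adj xy.
- by have /orP[] := IHs y sP uE => /(connect_trans (connect1 xy'))->; rewrite ?orbT.
- by rewrite connect0.
- by rewrite orbT.
Qed.

(* The common neighbors of u and v make the lift decodable: it contains both
   {u,c} and {v,c} for some common neighbor c in the first case only, and in the
   second case the new edge is the only one joining u or v to a common neighbor. *)
Definition new_edge : {set T} :=
  if [pick c | common c && ([set u; c] \in F)] is Some c then [set v; c]
  else if connect (adj pre_lift) c0 u then [set v; c0] else [set u; c0].

Definition lift := new_edge |: pre_lift.

Lemma common_split c : common c -> [set u; c] \in F -> [set u; c] \in pre_lift.
Proof.
move=> /andP[uc _] ucF; have := imset_f split_set ucF.
by rewrite /split_set edges2 // uc andbF.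
Qed.

(** The new edge joins the part of [u] to the part of [v], and it raises the edge bound by one, just
    as restoring [v] raises the vertex count. *)
Lemma lift_tree : tree V e lift.
Proof.
have pre_sub x y : connect (adj pre_lift) x y -> connect (adj lift) x y.
  apply: connect_sub => {}x {}y xy; apply: connect1.
  by rewrite /adj /= /lift inE -[_ \in pre_lift]/(adj pre_lift x y) xy orbT.
have c0V : c0 \in V :\ v.
  rewrite !inE (e_supp (x := c0) (y := u)) ?andbT 1?e_sym //.
  by apply: contraTneq vc0 => ->; rewrite e_irr.
have newE : adj lift =2 [rel x y | ([set x; y] == new_edge) || adj pre_lift x y].
  by move=> x y; rewrite /adj /= /lift !inE.
(* Either [c] links [u] and [v] directly, or [c0] already reaches one of them and the new edge joins
   it to the other. *)
have con_uv : connect (adj lift) u v.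
  move: newE; rewrite /new_edge; case: pickP => [c /andP[cc ucF]|_] newE.
    apply: (@connect_trans _ _ c); first by apply/pre_sub/connect1/common_split.
    by rewrite connect_adjC; apply: connect1; rewrite newE /= eqxx.
  have := pre_lift_reach c0V; case: ifP newE => [c0u|nc0u] newE /=.
    move=> _; rewrite connect_adjC; apply: connect_trans (pre_sub _ _ c0u).
    by apply: connect1; rewrite newE /= eqxx.
  by move/pre_sub; apply: connect_trans; apply: connect1; rewrite newE /= eqxx.
have subF x y : connect (adj F) x y -> connect (adj lift) x y.
  apply: connect_sub => {}x {}y /pre_lift_adj.
  case/or3P=> [/connect1/pre_sub//|/andP[/eqP->]|/andP[/eqP->]] /connect1/pre_sub.
    exact: connect_trans.
  by move=> xv; apply: connect_trans xv _; rewrite connect_adjC.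
have /and3P[_ /forall_inP conF ltF] := F_tree.
have con_u x : x \in V -> connect (adj lift) x u.
  have [-> _|xv xV] := eqVneq x v; first by rewrite connect_adjC.
  have xV' : x \in V :\ v by rewrite !inE xv.
  by apply/subF/(forall_inP (conF x xV')); rewrite !inE neq_uv (e_supp uc0).
apply/and3P; split.
- rewrite subUset sub1set; apply/andP; split; last first.
    by apply/subsetP=> E /imsetP[E' E'F ->]; apply: split_set_edge.
  rewrite /new_edge; case: pickP => [c /andP[/andP[_ vc] _]|_]; first by rewrite edges2.
  by case: ifP; rewrite edges2.
- apply/forall_inP=> x /con_u xu; apply/forall_inP=> y /con_u.
  by rewrite connect_adjC; apply: connect_trans.
- apply: leq_ltn_trans _ (_ : #|F|.+1 < _).
    by rewrite cardsU1 -add1n leq_add ?leq_b1 ?leq_imset_card.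
  by rewrite (cardsD1 v V) (e_supp vc0).
Qed.

(** The test detects which case of [new_edge] occurred. In the first, projection merges the new edge
    with its twin; in the second, the new edge is the only shared one and is discarded. *)
Definition unlift F' : {set {set T}} :=
  if [exists c, [&& common c, [set u; c] \in F' & [set v; c] \in F']]
  then proj_set @: F' else proj_set @: (F' :\: shared_edges).

Lemma liftK : unlift lift = F.
Proof.
have preK : proj_set @: pre_lift = F.
  rewrite -imset_comp -[RHS]imset_id; apply: eq_in_imset => E EF /=.
  exact: split_setK.
have proj_vc c : common c -> proj_set [set v; c] = [set u; c].
  move=> /andP[_ vc]; rewrite /proj_set set21 setU1K // inE.
  by apply: contraTneq vc => ->; rewrite e_irr.
rewrite /unlift /lift /new_edge; case: pickP => [c /andP[cc ucF]|no_c].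
  rewrite ifT; last first.
    by apply/existsP; exists c; rewrite cc setU11 inE common_split ?orbT.
  by rewrite imsetU1 preK proj_vc // setUC; apply/setUidPl; rewrite sub1set.
(* A shared edge of the pre-lift would project to some {u, c} in [F], which this case excludes. *)
have pre_shared E : E \in pre_lift -> E \notin shared_edges.
  move=> /imsetP[E' E'F EE]; rewrite inE; apply/existsP=> -[c /andP[cc Ec]].
  have E'c : E' = [set u; c].
    rewrite -(split_setK E'F) -EE; case/orP: Ec => /eqP->; last exact: proj_vc.
    rewrite /proj_set ifN // !inE negb_or eq_sym neq_uv.
    by case/andP: cc => _; apply: contraTneq => ->; rewrite e_irr.
  by have := no_c c; rewrite cc -E'c E'F.
set new := (if connect _ _ _ then _ else _).
have new_sh : new \in shared_edges.
  rewrite inE; apply/existsP; exists c0; rewrite /common uc0 vc0 /= /new.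
  by case: ifP; rewrite eqxx ?orbT.
rewrite ifF; last first.
  apply/negbTE/existsP=> -[c /and3P[cc]]; rewrite !in_setU1.
  have uc_sh : [set u; c] \in shared_edges.
    by rewrite inE; apply/existsP; exists c; rewrite cc eqxx.
  have vc_sh : [set v; c] \in shared_edges.
    by rewrite inE; apply/existsP; exists c; rewrite cc eqxx orbT.
  case/orP=> [/eqP En|/pre_shared]; last by rewrite uc_sh.
  case/orP=> [/eqP|/pre_shared]; last by rewrite vc_sh.
  rewrite -En => /set2_eq[[vu _]|[vc cu]]; first by move: neq_uv; rewrite vu eqxx.
  by case/andP: cc; rewrite cu e_irr.
rewrite setDUl.
have ->: [set new] :\: shared_edges = set0 by apply/eqP; rewrite setD_eq0 sub1set.
rewrite set0U (setDidPl _) ?preK // disjoint_sym disjoints_subset.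
apply/subsetP=> E Esh; rewrite inE; apply: contraL Esh; exact: pre_shared.
Qed.

End Lift.

Lemma identify_trees : #|trees (V :\ v) identify| <= #|trees V e|.
Proof.
have injl : {in trees (V :\ v) identify &, injective lift}.
  by apply: (can_in_inj (g := unlift)) => F; rewrite inE => /liftK.
rewrite -(card_in_imset injl); apply/subset_leq_card/subsetP=> F' /imsetP[F].
by rewrite !inE => /lift_tree tF ->.
Qed.

End Identification.

(** * Induction on the number of vertices, and the theorem *)

(* No proper coloring with k - 1 colors, hence the successor. *)
Definition uncolorable (T : finType) (V : {set T}) (e : rel T) k :=
  forall f : T -> nat, (forall x y, e x y -> f x != f y) ->
  exists2 x, x \in V & k <= (f x).+1.

Lemma card_trees_lower_bound k (T : finType) (V : {set T}) (e : rel T) :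
  symmetric e -> irreflexive e -> (forall x y, e x y -> x \in V) ->
  {in V &, forall x y, connect e x y} -> uncolorable V e k ->
  0 < k -> k ^ (k - 2) <= #|trees V e|.
Proof.
have [n leV] := ubnPleq #|V|.
elim: n V e leV => [|n IHn] V e leV e_sym e_irr e_supp e_con e_chr k_gt0.
  (* Here [V] is empty, yet an injective coloring makes [e_chr] yield a vertex of [V]. *)
  have [|x] := e_chr (fun x => enum_rank x).
    by move=> x y; apply: contraTneq => /ord_inj/enum_rank_inj->; rewrite e_irr.
  by move: leV; rewrite leqn0 cards_eq0 => /eqP->; rewrite inE.
have [/existsP[u /existsP[v /existsP[c]]]|] :=
    boolP [exists u, exists v, exists c, [&& u != v, ~~ e u v, e u c & e v c]].
  case/and4P=> neq_uv nuv uc vc.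
  apply: leq_trans (identify_trees e_sym e_irr e_supp neq_uv nuv uc vc).
  apply: IHn => //.
  - by move: leV; rewrite (cardsD1 v V) (e_supp _ _ vc).
  - exact: identify_sym.
  - exact: identify_irr.
  - exact: identify_supp uc.
  - exact: identify_connected.
  - move=> f fP; have [x y exy|x xV kx] := e_chr (f \o proj u v).
      by apply/fP/proj_edge.
    exists (proj u v x) => //; rewrite /proj !inE.
    have [_|nxv] /= := eqVneq x v; first by rewrite neq_uv (e_supp _ _ uc).
    by rewrite nxv.
rewrite negb_exists => /forallP none.
have complete : {in V &, forall x y, x != y -> e x y}.
  move=> x y xV yV; have /connectP[s] := e_con x y xV yV.
  (* With no two nonadjacent vertices sharing a neighbor, a walk from [x] never leaves its closed
     neighborhood. *)
  suff walk s' z : (z == x) || e x z -> path e z s' -> (last z s' == x) || e x (last z s').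
    move=> /walk + yE nxy; rewrite -yE eqxx => /(_ isT).
    by rewrite eq_sym (negbTE nxy).
  elim: s' z => //= w s' IHs z xz /andP[zw]; apply: IHs.
  have [//|nwx] := eqVneq w x; case/orP: xz => [/eqP<-//|xz] /=.
  have /existsPn/(_ w)/existsPn/(_ z) := none x.
  by rewrite eq_sym nwx xz [e w z]e_sym zw /= andbT negbK.
have le_kV : k <= #|V|.
  (* Positions in [enum V] give a proper coloring with [#|V|] colors on [V]. *)
  have [|x xV] := e_chr (fun x => index x (enum V)).
    move=> x y exy; apply: contraTneq (exy) => E.
    have xV : x \in enum V by rewrite mem_enum (e_supp _ _ exy).
    have yV : y \in enum V by rewrite mem_enum (e_supp y x) // e_sym.
    by rewrite -(nth_index x xV) E nth_index // e_irr.
  by move/leq_trans; apply; rewrite cardE index_mem mem_enum.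
have V0 : V != set0 by rewrite -card_gt0 (leq_trans k_gt0).
apply: leq_trans (cayley_lower_bound V0 complete).
apply: leq_trans _ (_ : #|V| ^ (k - 2) <= _).
  by case: (k - 2) => // m; rewrite leq_exp2r.
by rewrite leq_pexp2l ?leq_sub2r // (leq_trans k_gt0).
Qed.

(** At [k = 1] the truncated exponent is 0, and 1 ^ 0 agrees with the intended value 1. *)
Theorem theorem1 (k : nat) (hk : 1 <= k) (T : finType) (e : rel T)
    (e_sym : symmetric e) (e_irr : irreflexive e)
    (e_conn : connected_graph e) (e_chr : chromatic e k) :
  k ^ (k - 2) <= #|spanning_trees e|.
Proof.
apply: leq_trans (subset_leq_card (trees_spanning e)).
apply: card_trees_lower_bound => //; first by move=> x y _ _; have /forallP/(_ x)/forallP := e_conn.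
(* Otherwise all colors lie below [k.-1], giving a coloring that [e_chr] excludes. *)
move=> f fP; apply/exists_inP; apply: contraTT e_chr.
rewrite negb_exists_in => /forall_inP small; rewrite negb_and negbK; apply/orP; right.
have ltf x : f x < k.-1 by have := small x (in_setT x); lia.
apply/existsP; exists [ffun x => Ordinal (ltf x)].
apply/forallP=> x; apply/forallP=> y; apply/implyP=> /fP; rewrite !ffunE.
by apply: contraNneq => /(congr1 val)/= ->.
Qed.
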